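(* The chromatic number of $\mathbb{R}_{1}^n$ with forbidden odd distances does not exceed $n!\cdot n\cdot \ln n \cdot (4+o(1))$ as $n \to \infty$. That is, for every $\varepsilon>0$ there exists $n_0$ such that for all $n\ge n_0$ the points of $\mathbb{R}^n$ can be colored with at most $(4+\varepsilon)\, n!\, n\ln n$ colors so that the Manhattan distance between any two points of the same color is not an odd integer.
   Context: $\mathbb{R}^n_{1}$ denotes $\mathbb{R}^n$ equipped with the Manhattan metric $\|\mathbf{x}-\mathbf{y}\|_{1} = \sum_{i=1}^n |x_i-y_i|$. The chromatic number of $\mathbb{R}^n_1$ with forbidden odd distances is the minimum number of colors in a coloring of all points of $\mathbb{R}^n$ such that no two points of the same color are at Manhattan distance equal to an odd integer. *)

(* Defs.v *)
From HB Require Import structures.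
From mathcomp Require Import all_boot all_order all_algebra.
From mathcomp Require Import all_classical all_reals all_analysis.
Set Implicit Arguments.
Unset Strict Implicit.
Unset Printing Implicit Defensive.
Import Order.TTheory GRing.Theory Num.Theory.
Local Open Scope ring_scope.

(* The norm that MathComp-Analysis puts on ['rV[R]_n] is the max norm, so the
   Manhattan distance is written out. *)
Definition manhattan_dist (R : realType) (n : nat) (x y : 'rV[R]_n) : R :=
  \sum_(i < n) `|x 0 i - y 0 i|.

Definition odd_integer (R : realType) (d : R) : Prop :=
  exists m : int, d = (2 * m + 1)%:~R.

Definition odd_free_coloring (R : realType) (n k : nat)
    (c : 'rV[R]_n -> 'I_k) : Prop :=
  forall x y : 'rV[R]_n, c x = c y -> ~ odd_integer (manhattan_dist x y).

Definition odd_free_colorable (R : realType) (n k : nat) : Prop :=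
  exists c : 'rV[R]_n -> 'I_k, odd_free_coloring c.

(* A relation rather than a function: that a finite chromatic number exists is
   then part of any claim made about it. *)
Definition is_odd_chromatic_number (R : realType) (n k : nat) : Prop :=
  odd_free_colorable R n k /\
  forall m : nat, odd_free_colorable R n m -> (k <= m)%N.

(* Main.v *)
Require Import Defs.
From HB Require Import structures.
From mathcomp Require Import all_boot all_order all_algebra.
From mathcomp Require Import all_classical all_reals all_analysis.
From mathcomp Require Import zify ring lra.
Set Implicit Arguments.
Unset Strict Implicit.
Unset Printing Implicit Defensive.
Import Order.TTheory GRing.Theory Num.Theory.

(* Let L be the lattice of integer vectors with even coordinate sum. Any two of
   its points are at an even Manhattan distance, so the union L + B of the open
   balls of radius 1/2 centred on L contains no two points at an odd distance.
   The set Z^n + B has density 1/n! and splits into two translates of L + B, so if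
   N translates of Z^n + B cover the space, then 2N colours suffice.
   The covering is found greedily after rounding to the grid (1/2m) Z^n modulo
   Z^n, which has (2m)^n points. With m a large multiple of n^2 rounding changes
   the density only by a factor close to 1, and the greedy choice needs about
   N = n! ln ((2m)^n) ~ 2 n! n ln n translates. *)

(** * Greedy covering by a finite relation *)

(** Double counting the related pairs with first entry in [U]: on average [t] covers at least
    [#|U| * s / #|T|] points of [U]. *)
Lemma exists_shift_above_average (X T : finType) (r : X -> T -> bool) (s : nat)
    (t0 : T) (U : {set X}) :
  (forall x, s <= #|[set t | r x t]|)%N ->
  exists t, (#|U :\: [set x | r x t]| * #|T| <= #|U| * (#|T| - s))%N.
Proof.
move=> rs.
have dc : (#|U| * s <= \sum_t #|U :&: [set x | r x t]|)%N.
  have -> : (\sum_t #|U :&: [set x | r x t]|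
             = \sum_(x in U) #|[set t | r x t]|)%N.
    transitivity (\sum_t \sum_(x in U) r x t)%N.
      apply: eq_bigr => t _; rewrite -sum1_card -big_mkcondr /=.
      by apply: eq_bigl => x; rewrite !inE.
    rewrite exchange_big /=; apply: eq_bigr => x _.
    by rewrite -sum1_card -big_mkcond /=; apply: eq_bigl => t; rewrite inE.
  by rewrite -sum_nat_const; apply: leq_sum.
have [t _ tmax] := @arg_maxnP _ t0 predT (fun t => #|U :&: [set x | r x t]|) isT.
exists t.
have ave : (#|U| * s <= #|U :&: [set x | r x t]| * #|T|)%N.
  apply: leq_trans dc _; rewrite mulnC -sum_nat_const.
  by apply: leq_sum => t' _; apply: tmax.
rewrite cardsD mulnBl mulnBr; lia.
Qed.

(** Each greedy choice multiplies the number of uncovered points by at most [1 - s / #|T|]; the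
    second hypothesis brings the count after [N] choices below one. *)
Lemma greedy_cover (X T : finType) (r : X -> T -> bool) (s N : nat) :
  (forall x, s <= #|[set t | r x t]|)%N ->
  (#|X| * (#|T| - s) ^ N < #|T| ^ N)%N ->
  exists f : 'I_N -> T, forall x, exists j, r x (f j).
Proof.
move=> rs hN.
(* With [T] empty the strict inequality forces [N = 0] and [X] empty. *)
have [t0|T0] := pickP (@predT T); last first.
  have T00 : #|T| = 0%N by apply: eq_card0 => t; have := T0 t.
  case: N hN => [|N]; last by rewrite T00 exp0n.
  rewrite !expn0 muln1 ltnS leqn0 => /eqP X0.
  have f : 'I_0 -> T by case.
  by exists f => x; have := card0_eq X0 x.
move=> _.
suff [f uf] : exists f : 'I_N -> T,
    (#|[set x | [forall j, ~~ r x (f j)]]| * #|T| ^ N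
     <= #|X| * (#|T| - s) ^ N)%N.
  exists f => x; apply/existsP; apply: contraT; rewrite negb_exists => ux.
  have : (0 < #|[set x | [forall j, ~~ r x (f j)]]|)%N.
    by apply/card_gt0P; exists x; rewrite inE.
  move=> u0; have := leq_ltn_trans uf hN; nia.
elim: N {hN} => [|N [f uf]].
  by exists (fun=> t0); rewrite !muln1 max_card.
set U := [set x | _] in uf.
have [t ht] := exists_shift_above_average t0 U rs.
exists (fun j => oapp f t (unlift ord_max j)).
rewrite !expnS mulnA [X in (_ <= X)%N]mulnCA.
have /subset_leq_card US : [set x | [forall j : 'I_N.+1,
    ~~ r x (oapp f t (unlift ord_max j))]] \subset U :\: [set x | r x t].
  apply/fintype.subsetP => x; rewrite !inE => /forallP h.
  have := h ord_max; rewrite unlift_none /= => ->.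
  by apply/forallP => j; have := h (lift ord_max j); rewrite liftK.
apply: (@leq_trans (#|U| * (#|T| - s) * #|T| ^ N)%N).
  rewrite leq_mul2r; apply/orP; right; apply: leq_trans ht.
  by rewrite leq_mul2r US orbT.
by rewrite mulnAC mulnC leq_mul2l uf orbT.
Qed.

(** * Rounded balls on the grid modulo [2 m] *)

Local Open Scope ring_scope.

(* With [v_i] the residue of [z_i - t_i] modulo [2 m], half the sum below is the
   Manhattan distance from [v] to the centre of the cube [0, 2 m - 1]^n. *)
Definition near_center (n m : nat) (t : {ffun 'I_n -> 'I_(2 * m)})
    (z : 'I_n -> int) : bool :=
  \sum_(i < n) `|2 * ((z i - (t i : nat)%:Z) %% (2 * m)%N)%Z + 1 - (2 * m)%N%:Z|
    + n%:Z < (2 * m)%N%:Z.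

(** Write each residue as [m + a_i] or [m - 1 - a_i]; its term in [near_center] is then [2 a_i + 1].
    The condition becomes [\sum a_i <= m - 1 - n], which has ['C(m.-1, n)] solutions, and the
    choices of side give [2 ^ n]. *)
Lemma card_near_center (n m : nat) (z : 'I_n -> int) : (n < m)%N ->
  ('C(m.-1, n) * 2 ^ n <=
   #|[set t : {ffun 'I_n -> 'I_(2 * m)} | near_center t z]|)%N.
Proof.
move=> nm.
have m2 : (0 < 2 * m)%N by lia.
have m2z : (2 * m)%N%:Z != 0 by lia.
pose q := (m.-1 - n)%N.
pose A := [set a : n.-tuple 'I_q.+1 | \sum_(i <- a) i <= q]%N.
pose v (p : n.-tuple 'I_q.+1 * {ffun 'I_n -> bool}) (i : 'I_n) : nat :=
  if p.2 i then (m + tnth p.1 i)%N else (m.-1 - tnth p.1 i)%N.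
have lq (a : n.-tuple 'I_q.+1) i : (tnth a i <= m.-1 - n)%N.
  by rewrite -ltnS; exact: ltn_ord.
have vlt p i : (v p i < 2 * m)%N.
  by rewrite /v; have := lq p.1 i; case: (p.2 i); lia.
have tP p i : (`|((z i - (v p i)%:Z) %% (2 * m)%N)%Z|%N < 2 * m)%N.
  have := ltz_pmod (z i - (v p i)%:Z) (d := (2 * m)%N) m2.
  have := modz_ge0 (z i - (v p i)%:Z) m2z. lia.
pose t p : {ffun 'I_n -> 'I_(2 * m)} := [ffun i => Ordinal (tP p i)].
have tv p i : ((z i - (t p i : nat)%:Z) %% (2 * m)%N)%Z = v p i.
  rewrite ffunE /= gez0_abs ?modz_ge0 //.
  rewrite -modzDmr modzNm modzDmr opprB addrC subrK modz_small //.
  by have := vlt p i; lia.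
have -> : ('C(m.-1, n) * 2 ^ n = #|finset.setX A [set: {ffun 'I_n -> bool}]|)%N.
  rewrite cardsX cardsT card_ffun card_bool card_ord card_partial_ord_partitions.
  by congr ('C(_, _) * _)%N; rewrite /q; lia.
rewrite -(@card_in_imset _ _ t); last first.
  move=> [a e] [b f] _ _ /= tab.
  have vab i : v (a, e) i = v (b, f) i.
    by apply/eqP; rewrite -eqz_nat -!tv tab.
  have ab i : e i = f i /\ tnth a i = tnth b i.
    have := vab i; rewrite /v /= => {vab}.
    have := lq a i; have := lq b i.
    by case: (e i); case: (f i) => ? ? h; split => //; try apply: val_inj => /=; lia.
  by congr (_, _); [apply: eq_from_tnth => i | apply/ffunP => i]; case: (ab i).
apply/subset_leq_card/fintype.subsetP => _ /imsetP[[a e] + ->]; rewrite !inE andbT /= => aq.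
rewrite /near_center.
under eq_bigr => i _ do rewrite tv.
have -> : \sum_(i < n) `|2 * (v (a, e) i)%:Z + 1 - (2 * m)%N%:Z|
          = (2 * \sum_(i <- a) i + n)%N%:Z.
  rewrite big_tuple big_distrr -[X in (_ + X)%N]card_ord -sum1_card -big_split /=.
  rewrite (big_morph Posz PoszD (erefl _)); apply: eq_bigr => i _.
  by have := lq a i; rewrite /v /=; case: (e i); lia.
move: aq; move: (\sum_(_ <- _) _)%N => S aq; rewrite /q in aq.
lia.
Qed.

(** Triangle inequality through the centre of the cube. The term [n] is kept to absorb the rounding
    of [n] real coordinates. *)
Lemma near_center_dist (n m : nat) (t : {ffun 'I_n -> 'I_(2 * m)})
    (z z' : 'I_n -> int) : near_center t z -> near_center t z' ->
  \sum_(i < n) `|((z i - (t i : nat)%:Z) %% (2 * m)%N)%Z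
                 - ((z' i - (t i : nat)%:Z) %% (2 * m)%N)%Z|
    + n%:Z < (2 * m)%N%:Z.
Proof.
rewrite /near_center => hz hz'.
set S := \sum_(i < n) _ in hz; set S' := \sum_(i < n) _ in hz'.
set D := \sum_(i < n) _.
suff : 2 * D <= S + S' by lia.
rewrite /D /S /S' mulr_sumr -big_split /=; apply: ler_sum => i _; lia.
Qed.

(** * From a covering to a colouring *)

(** This makes the parity of an integer Manhattan distance additive, so that a colour can store one
    parity per point. *)
Lemma dvdz2_sum_abs (n : nat) (w : 'I_n -> int) :
  (2 %| \sum_(i < n) `|w i|)%Z = (2 %| \sum_(i < n) w i)%Z.
Proof.
have even_diff : (2 %| \sum_(i < n) (w i - `|w i|))%Z.
  apply: rpred_sum => i _; rewrite -[_ \in _]/(2 %| _)%Z.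
  have [wi|wi] := lerP 0 (w i); first by rewrite ?ger0_norm // subrr dvdz0.
  by rewrite ltr0_norm // opprK -mulr2n -[w i *+ 2]mulr_natl dvdz_mulr.
rewrite -[LHS](rpredDr _ even_diff) -big_split /=.
by under eq_bigr => i _ do rewrite addrC subrK.
Qed.

Lemma odd_free_colorable_of_cover (R : realType) (n m N : nat)
    (f : 'I_N -> {ffun 'I_n -> 'I_(2 * m)}) :
  (0 < m)%N -> (forall z : 'I_n -> int, exists j, near_center (f j) z) ->
  odd_free_colorable R n (N * 2).
Proof.
move=> m0 cover.
set M := (2 * m)%N; have [r rE] : {r : R | r = M%:~R} by exists M%:~R.
have M0 : 0 < r by rewrite rE ltr0z /M; lia.
pose F (x : 'rV[R]_n) i := Num.floor (r * x 0 i).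
have [c hc] := choice (fun x => cover (F x)).
pose w j x i := ((F x i - (f j i : nat)%:Z) %/ M)%Z.
pose v j x i := ((F x i - (f j i : nat)%:Z) %% M)%Z.
(* The first entry names a translate containing the rounded point; the parity tells which of the two
   cosets of [L] in Z^n the centre of its ball comes from. *)
pose col x : 'I_N * bool := (c x, (2 %| \sum_(i < n) w (c x) x i)%Z).
have cardC : #|{: 'I_N * bool}| = (N * 2)%N.
  by rewrite card_prod card_ord card_bool.
exists (fun x => cast_ord cardC (enum_rank (col x))) => x y.
move=> /cast_ord_inj/enum_rank_inj [cxy]; rewrite -cxy; set j := c x => parity.
pose W := \sum_(i < n) `|w j x i - w j y i|.
have Weven : (2 %| W)%Z.
  rewrite dvdz2_sum_abs big_split /= sumrN.
  have even_sub (a b : int) : (2 %| a)%Z = (2 %| b)%Z -> (2 %| a - b)%Z by lia.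
  exact: even_sub parity.
(* In each coordinate the scaled difference is [r * (w - w')] plus [v - v'] plus a difference of
   fractional parts; the latter cost at most [n] in total. *)
have close : `|r * manhattan_dist x y - r * W%:~R| < r.
  have hD : (\sum_(i < n) `|v j x i - v j y i| + n%:Z)%:~R < r.
    by rewrite rE ltr_int; apply: near_center_dist; [exact: hc | rewrite /j cxy; exact: hc].
  apply: le_lt_trans hD.
  rewrite /manhattan_dist /W intrD !rmorph_sum /= !mulr_sumr -sumrB.
  have -> : n%:~R = \sum_(i < n) 1 :> R by rewrite sumr_const card_ord.
  rewrite -big_split /=; apply: le_trans (ler_norm_sum _ _ _) _.
  apply: ler_sum => i _.
  have Fx (u : 'rV[R]_n) : exists2 e : R, 0 <= e < 1 &
      r * u 0 i = (f j i)%:R + r * (w j u i)%:~R + (v j u i)%:~R + e.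
    exists (r * u 0 i - (F u i)%:~R).
      by have := floor_itv (r * u 0 i); rewrite -/(F u i) intrD; lra.
    have := divz_eq (F u i - (f j i : nat)%:Z) M; rewrite -/(w j u i) -/(v j u i).
    move=> /(congr1 (fun k : int => k%:~R : R)); rewrite rmorphB rmorphD rmorphM /= -rE => Fdiv.
    have fj : (f j i : nat)%:~R = (f j i)%:R :> R by [].
    lra.
  have [e he ex] := Fx x; have [e' he' ey] := Fx y.
  have -> : r * `|x 0 i - y 0 i| = `|r * x 0 i - r * y 0 i|.
    by rewrite -mulrBr normrM (gtr0_norm M0).
  have -> : r * `|w j x i - w j y i|%:~R
            = `|r * ((w j x i)%:~R - (w j y i)%:~R)| :> R.
    by rewrite normrM (gtr0_norm M0) -rmorphB intr_norm.
  apply: le_trans (ler_dist_dist _ _) _; rewrite ex ey intr_norm intrB.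
  set p := (w j x i)%:~R; set p' := (w j y i)%:~R.
  set q := (v j x i)%:~R; set q' := (v j y i)%:~R.
  rewrite [X in `|X|](_ : _ = q - q' + (e - e')); last by ring.
  by apply: le_trans (ler_normD _ _) _; rewrite lerD2l ler_norml; lra.
(* An odd distance would lie less than 1 away from the even integer [W]. *)
move=> [k dk]; move: close.
rewrite dk -mulrBr normrM (gtr0_norm M0) gtr_pMr // -rmorphB -intr_norm.
by rewrite -[1]/(1%:~R) ltr_int; lia.
Qed.

(** * Estimates for the number of translates *)

Lemma expn_le_ffact (k n : nat) : ((k.+1 - n) ^ n <= k ^_ n)%N.
Proof.
elim: n k => [|n IHn] k; first by [].
case: k => [|k]; first by rewrite subSS sub0n exp0n.
by rewrite ffactSS expnS subSS; apply: leq_mul; [lia | exact: IHn].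
Qed.

Lemma bernoulli_ineq (R : realDomainType) (x : R) (n : nat) :
  0 <= x <= 1 -> 1 - n%:R * x <= (1 - x) ^+ n.
Proof.
move=> /andP[x0 x1]; elim: n => [|n IHn]; first by rewrite mul0r subr0 expr0.
rewrite exprS; apply: (@le_trans _ _ ((1 - x) * (1 - n%:R * x))).
  by rewrite -natr1; have := ler0n R n; nra.
by rewrite ler_wpM2l // subr_ge0.
Qed.

(** By [1 - x <= exp (- x)], the ratio of the two sides is at most [exp (ln K - N * s / K)], which
    is below 1. *)
Lemma expn_sub_lt (R : realType) (K s N : nat) : (0 < K)%N -> (s <= K)%N ->
  K%:R * ln (K%:R : R) < N%:R * s%:R -> (K * (K - s) ^ N < K ^ N)%N.
Proof.
move=> K0 sK h; have K0R : 0 < K%:R :> R by rewrite ltr0n.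
rewrite -(ltr_nat R) natrM !natrX natrB //.
have -> : K%:R - s%:R = K%:R * (1 - s%:R / K%:R) :> R by field; rewrite gt_eqF.
rewrite exprMn mulrCA gtr_pMr ?exprn_gt0 //.
have : (1 - s%:R / K%:R) ^+ N <= expR (- (N%:R * s%:R / K%:R)) :> R.
  have -> : - (N%:R * s%:R / K%:R) = N%:R * - (s%:R / K%:R) :> R by ring.
  rewrite expRM_natl; apply: lerXn2r; rewrite ?nnegrE ?expR_ge0 //.
    by rewrite subr_ge0 ler_pdivrMr // mul1r ler_nat.
  exact: expR_ge1Dx.
move=> /(ler_wpM2l (ltW K0R)) /le_lt_trans -> //.
rewrite -{1}[K%:R](@lnK R) ?posrE // -expRD expR_lt1 subr_lt0.
by rewrite ltr_pdivlMr // mulrC.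
Qed.

(** The binomial is at least [(m - n) ^ n / n!], and Bernoulli gives
    [(1 - n / m) ^ n >= 1 - n ^ 2 / m], which equals [D / (D + 1)] for this [m]. *)
Lemma center_density (R : realType) (D n : nat) : (0 < D)%N -> (0 < n)%N ->
  let m := (D.+1 * n ^ 2)%N in
  D%:R / D.+1%:R / (n`!)%:R * ((2 * m) ^ n)%:R <= ('C(m.-1, n) * 2 ^ n)%:R :> R.
Proof.
move=> D0 n0; set m := (D.+1 * n ^ 2)%N; cbv zeta.
have m0 : (0 < m)%N by rewrite muln_gt0 expn_gt0 n0.
have m0R : 0 < m%:R :> R by rewrite ltr0n.
have nm : (n <= m)%N by rewrite /m; nia.
have f0 : 0 < (n`!)%:R :> R by rewrite ltr0n fact_gt0.
rewrite expnMn !natrM [X in X <= _](_ : _ =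
  (2 ^ n)%:R * (D%:R / D.+1%:R * (m ^ n)%:R / (n`!)%:R)); last by ring.
rewrite [X in _ <= X]mulrC ler_pM2l ?ltr0n ?expn_gt0 // ler_pdivrMr //.
rewrite -natrM bin_ffact.
have := expn_le_ffact m.-1 n; rewrite prednK // -(ler_nat R); apply: le_trans.
have -> : D%:R / D.+1%:R = 1 - n%:R * (n%:R / m%:R) :> R.
  rewrite /m natrM natrX -natr1; field.
  by rewrite natr1 !gt_eqF // ltr0n.
have -> : ((m - n) ^ n)%:R = (1 - n%:R / m%:R) ^+ n * (m ^ n)%:R :> R.
  rewrite !natrX -exprMn natrB //; congr (_ ^+ n).
  by field; rewrite gt_eqF.
apply: ler_wpM2r => //; apply: bernoulli_ineq.
by rewrite divr_ge0 //= ler_pdivrMr // mul1r ler_nat.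
Qed.

(** * Assembling the bound *)

(** Since [near_center] depends only on [z] modulo [2 m], a greedy covering of the finite torus
    covers all integer vectors. *)
Lemma exists_center_cover (n m N : nat) : (n < m)%N ->
  ((2 * m) ^ n * ((2 * m) ^ n - 'C(m.-1, n) * 2 ^ n) ^ N < ((2 * m) ^ n) ^ N)%N ->
  exists f : 'I_N -> {ffun 'I_n -> 'I_(2 * m)},
    forall z : 'I_n -> int, exists j, near_center (f j) z.
Proof.
move=> nm hN; have M0 : (2 * m)%N != 0 :> int by lia.
pose r (x t : {ffun 'I_n -> 'I_(2 * m)}) := near_center t (fun i => (x i : nat)%:Z).
have cardT : #|{: {ffun 'I_n -> 'I_(2 * m)}}| = ((2 * m) ^ n)%N.
  by rewrite card_ffun !card_ord.
have [||f cover] := @greedy_cover _ _ r ('C(m.-1, n) * 2 ^ n)%N N.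
- by move=> x; apply: card_near_center.
- by rewrite cardT.
exists f => z.
have zP i : (`|(z i %% (2 * m)%N)%Z|%N < 2 * m)%N.
  have := ltz_pmod (z i) (d := (2 * m)%N); have := modz_ge0 (z i) M0; lia.
have [j cov] := cover [ffun i => Ordinal (zP i)]; exists j; move: cov.
rewrite /r /near_center; under eq_bigr => i _ do
  rewrite ffunE /= gez0_abs ?modz_ge0 // modzDml.
by [].
Qed.

Lemma odd_free_colorable_ln (R : realType) (D n : nat) : (0 < D)%N -> (0 < n)%N ->
  exists N : nat, odd_free_colorable R n (N * 2) /\
    N%:R <= 1 + (n`!)%:R * (1 + D%:R^-1) * n%:R * ln ((2 * (D.+1 * n ^ 2))%:R : R).
Proof.
move=> D0 n0; set m := (D.+1 * n ^ 2)%N.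
have nm : (n < m)%N by rewrite /m; nia.
set B := (n`!)%:R * _ * _ * _.
have l0 : 0 <= ln ((2 * m)%:R : R) by apply: ln_ge0; rewrite ler1n; lia.
have D0R : 0 < D%:R :> R by rewrite ltr0n.
have f0 : 0 < (n`!)%:R :> R by rewrite ltr0n fact_gt0.
have B0 : 0 <= B by rewrite /B !mulr_ge0 // addr_ge0 // invr_ge0 ler0n.
(* [B] is [K * ln K] divided by the lower bound that [center_density] gives for [s], with
   [ln K = n * ln (2 m)]. *)
exists (Num.truncn B).+1; split; last first.
  by rewrite -natr1 addrC lerD2l; have /andP[] := truncn_itv B0.
set K := ((2 * m) ^ n)%N; set s := ('C(m.-1, n) * 2 ^ n)%N.
have sK : (s <= K)%N.
  apply: leq_trans (card_near_center (fun=> 0) nm) _.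
  by apply: leq_trans (max_card _) _; rewrite card_ffun !card_ord.
have K0 : (0 < K)%N by rewrite expn_gt0; apply/orP; left; lia.
have [|f cover] := @exists_center_cover n m (Num.truncn B).+1 nm; last first.
  by apply: odd_free_colorable_of_cover cover; lia.
apply: (@expn_sub_lt R) => //.
have dens := center_density R D0 n0; rewrite -/m -/K -/s in dens.
apply: (@lt_le_trans _ _ ((Num.truncn B).+1%:R *
   (D%:R / D.+1%:R / (n`!)%:R * K%:R))); last by apply: ler_wpM2l dens.
have -> : K%:R * ln (K%:R : R) = B * (D%:R / D.+1%:R / (n`!)%:R * K%:R).
  rewrite /K [X in ln X]natrX lnXn ?ltr0n; last by lia.
  rewrite -mulr_natr /B -natr1; field.
  by rewrite natr1 !gt_eqF // ltr0n.
rewrite ltr_pM2r ?truncnS_gt //.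
by rewrite !mulr_gt0 // ?invr_gt0 ?ltr0n.
Qed.

Theorem mainTheorem5 (R : realType) (eps : R) (heps : 0 < eps) :
  exists n0 : nat, forall n : nat, (n0 <= n)%N ->
    exists k : nat,
      is_odd_chromatic_number R n k /\
      k%:R <= (4 + eps) * (n`!)%:R * n%:R * ln (n%:R : R).
Proof.
(* [D] ensures [8 / D < eps]; [b] is the part of [ln (2 m) = b + 2 ln n] free of [n]; [ln n >= L]
   ensures [2 + 4 b <= eps * ln n / 2]. *)
pose D := (Num.truncn (8 / eps)).+1.
pose b : R := ln (2 * D.+1%:R).
pose L := 2 / eps * (2 + 4 * b).
exists (Num.truncn (expR L)).+1 => n hn.
have n0 : (0 < n)%N by lia.
have n0R : 0 < n%:R :> R by rewrite ltr0n.
have lnL : L <= ln n%:R.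
  rewrite -[L]expRK ler_ln ?posrE ?expR_gt0 //.
  by apply: le_trans (ltW (truncnS_gt _)) _; rewrite ler_nat.
have D0 : 0 < D%:R :> R by rewrite ltr0n.
have Deps : 8 * D%:R^-1 < eps.
  by rewrite ltr_pdivrMr // mulrC -ltr_pdivrMr // truncnS_gt.
have [N [colN hN]] := odd_free_colorable_ln R (isT : (0 < D)%N) n0.
have col_ex : exists k, `[< odd_free_colorable R n k >].
  by exists (N * 2)%N; apply/asboolP.
have [k /asboolP colk kmin] := ex_minnP col_ex.
exists k; split; first by split=> // j /asboolP; exact: kmin.
have kN : k%:R <= N%:R * 2 :> R by rewrite -natrM ler_nat; apply/kmin/asboolP.
apply: le_trans kN _; move: hN.
have -> : ln ((2 * (D.+1 * n ^ 2))%:R : R) = b + 2 * ln n%:R.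
  rewrite mulnA natrM lnM ?posrE ?ltr0n ?expn_gt0 ?n0 // natrM natrX lnXn //.
  by rewrite -[X in _ + X]mulr_natl.
have b0 : 0 <= b by apply: ln_ge0; rewrite -natrM ler1n.
set l := ln n%:R in lnL *.
have eL : 2 * (2 + 4 * b) <= eps * l.
  move: lnL; rewrite /L mulrAC ler_pdivrMr //; lra.
have l0 : 0 <= l by apply: ln_ge0; rewrite ler1n.
have Dinv : D%:R^-1 <= 1 :> R by rewrite invf_le1 // ler1n.
have Dinv0 : 0 <= D%:R^-1 :> R by rewrite invr_ge0 ltW.
set d := D%:R^-1 in Dinv Dinv0 Deps *.
have P1 : 1 <= (n`!)%:R * n%:R :> R.
  by rewrite -natrM ler1n muln_gt0 fact_gt0.
rewrite -!mulrA (mulrCA (1 + d)) !mulrA => hN; rewrite -(mulrA (4 + eps)).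
set P := (n`!)%:R * n%:R in P1 hN *.
(* Half of [eps * l] pays for [2 + 4 * b], the other half for [4 * d * l]. Afterwards [1 <= P]
   absorbs the additive 2. *)
have : 2 + 2 * ((1 + d) * (b + 2 * l)) <= (4 + eps) * l.
  have : d * b <= b by nra.
  have : 8 * (d * l) <= eps * l by nra.
  nra.
nra.
Qed.
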